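(* Let $(I_k)_{k\ge 1}$ be a sequence of intervals in $\mathbb{R}$, where $I_k$ has length $r_k'\in(0,1)$, and let $$\widetilde{S}=\bigcap_{m\ge 1}\bigcup_{k\ge m} I_k .$$ If the series $\sum_k \frac{1}{|\log r_k'|}$ converges, then the set $\widetilde{S}$ is of zero capacity, i.e. $\mathrm{Cap}(\widetilde S)=0$.
   Context: For a compactly supported Borel measure $\mu$ on $\mathbb{C}$, its energy is $I(\mu):=\iint -\log|z-w|\,d\mu(z)\,d\mu(w)$ (possibly $+\infty$). For a bounded Borel set $X\subset\mathbb{C}$, let $\mathcal{P}(X)$ be the set of Borel probability measures supported on $X$ (i.e. $\mu(\mathbb{C}\setminus X)=0$); the logarithmic capacity of $X$ is $\mathrm{Cap}(X):=\exp(-\inf\{I(\mu)\mid \mu\in\mathcal{P}(X)\})$, with $\exp(-\infty)=0$ and $\inf\emptyset=+\infty$. Since capacity is defined for bounded sets, $\widetilde S$ is understood to be bounded; $\mathbb{R}$ is regarded as a subset of $\mathbb{C}$. *)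

(* Defs.v *)
From mathcomp Require Import all_boot all_order all_algebra complex.
From mathcomp Require Import all_classical all_reals all_analysis.
Import Order.TTheory GRing.Theory Num.Theory.
Import numFieldNormedType.Exports.

Set Implicit Arguments.
Unset Strict Implicit.
Unset Printing Implicit Defensive.

Local Open Scope classical_set_scope.
Local Open Scope ring_scope.

(* The complex plane R[i] with its Borel sigma-algebra. [R[i]^o] is R[i] as a
   normed space over itself, which is where its topology lives. *)
Notation borelC R := (g_sigma_algebraType (@open R[i]^o)).

(* -log|z - w|, equal to +oo on the diagonal z = w. *)
Definition log_kernel (R : realType) (z w : R[i]) : \bar R :=
  (- lne (Normc.normc (z - w))%:E)%E.

(* Only meaningful when [mu] is carried by a bounded set: the kernel is then
   bounded below mu x mu-almost everywhere and the iterated integral is the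
   double integral. *)
Definition energy (R : realType) (mu : probability (borelC R) R) : \bar R :=
  (\int[mu]_w \int[mu]_z log_kernel z w)%E.

Definition supported_probas (R : realType) (X : set R[i]) :
    set (probability (borelC R) R) :=
  [set mu | mu (~` X) = 0%E].

(* Only meaningful when X is bounded and Borel. Values are taken in [\bar R]
   so that [expeR (-oo) = 0] and [ereal_inf set0 = +oo] apply as they stand. *)
Definition capacity (R : realType) (X : set R[i]) : \bar R :=
  expeR (- ereal_inf [set energy mu | mu in supported_probas X])%E.

Definition real_in_C (R : realType) (A : set R) : set R[i] :=
  [set (x%:C)%C | x in A].

(* Main.v *)
Require Import Defs.
From mathcomp Require Import all_boot all_order all_algebra complex.
From mathcomp Require Import all_classical all_reals all_analysis.
From mathcomp Require Import measurable_realfun.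
Import Order.TTheory GRing.Theory Num.Theory.
Import numFieldNormedType.Exports.

Set Implicit Arguments.
Unset Strict Implicit.
Unset Printing Implicit Defensive.

Local Open Scope classical_set_scope.
Local Open Scope ring_scope.

(** Let mu be a probability carried by the limsup set X and let
    U w = \int -log|z - w| dmu(z) be its potential. The set X being bounded,
    the kernel is bounded below on X by some constant - L. If w lies in X and
    in I_k, every z in I_k satisfies |z - w| <= r_k, so
      U w >= |log r_k| * mu(I_k) - L.
    Hence the intervals I_k that contain a point of X where U <= n have measure
    at most (n + L) / |log r_k|, which is summable. By Borel-Cantelli, their
    limsup is null; this limsup contains every point of X where U <= n. Taking
    the union over n, U = +oo almost everywhere on X, so that every probability
    carried by X has infinite energy, and the capacity of X is exp(- oo) = 0.

    The argument uses only the diameters of the covering sets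
    (capacity_lim_sup_eq0); the measure-theoretic part, which concerns an
    arbitrary function bounded below as U is, is ae_pinfty_lim_sup_set.
    The integrals of the kernel and of U are compared with those of step
    functions only, through the definition of the integral as a supremum over
    simple functions (integral_ge_cstB); this replaces a proof, by Fubini, that
    U is measurable. *)

(** * Lower bounds of integrals *)

(** The integral of a nonnegative function is a supremum over the simple
    functions below it, and this family grows with the integrand. *)
Lemma ge0_le_integralT d (T : measurableType d) (R : realType)
    (mu : {measure set T -> \bar R}) (f g : T -> \bar R) :
  (forall x, 0 <= f x)%E -> (forall x, f x <= g x)%E ->
  (\int[mu]_x f x <= \int[mu]_x g x)%E.
Proof.
move=> f0 fg; have g0 x : (0 <= g x)%E by exact: le_trans (fg x).
rewrite !ge0_integralTE//; apply: le_ereal_sup => _ [h /= hf <-].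
by exists h => // x; exact: le_trans (fg x).
Qed.

(** The positive part of [f] is at least [c] on [A], and its negative part is at
    most [L] outside a null set. It is used twice: with [c] finite to bound the
    potential at a point, and with [c = +oo], [L = 0] to bound the energy. *)
Lemma integral_ge_cstB d (T : measurableType d) (R : realType)
    (mu : probability T R) (A X : set T) (f : T -> \bar R) (c : \bar R)
    (L : R) :
  measurable A -> measurable X -> mu (~` X) = 0%E ->
  (0 <= c)%E -> 0 <= L ->
  (forall x, A x -> c <= f x)%E -> (forall x, X x -> - L%:E <= f x)%E ->
  (c * mu A - L%:E <= \int[mu]_x f x)%E.
Proof.
move=> mA mX X0 c0 L0 cf Lf; rewrite integralE; apply: leeB.
  rewrite -integral_cst// integral_mkcond; apply: ge0_le_integralT => x.
    by apply: erestrict_ge0 => ? _.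
  rewrite patchE; case: ifPn => [/set_mem/cf fx|_]; last exact: funepos_ge0.
  by rewrite (le_trans fx)// funeposE le_max lexx.
(* Outside X nothing is known about f; the value +oo on a null set is harmless. *)
pose h := (((cst L%:E) \_ X) \+ ((cst +oo) \_ (~` X)))%E.
have : (\int[mu]_x h x <= L%:E)%E.
  rewrite ge0_integralD//.
  - rewrite -!integral_mkcond !integral_cst//; last exact: measurableC.
    rewrite [Y in (_ + _ * Y)%E]X0 mule0 adde0 -[leRHS]mule1.
    by rewrite lee_wpmul2l ?lee_fin ?probability_le1.
  - by move=> x _; apply: erestrict_ge0 => ? _; rewrite lee_fin.
  - exact: (measurable_restrictT _ mX).1.
  - by move=> x _; apply: erestrict_ge0 => ? _; exact: leey.
  - apply: (measurable_restrictT _ _).1; first exact: measurableC.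
    exact: measurable_cst.
apply: le_trans; apply: ge0_le_integralT => x; first exact: funeneg_ge0.
rewrite /h /= !patchE; case: ifPn => [|] xX.
  rewrite in_setC xX /= adde0 funenegE ge_max lee_fin L0 andbT leeNl.
  exact/Lf/set_mem.
by rewrite in_setC xX /= add0e leey.
Qed.

(** * The Borel-Cantelli argument *)

(** For each [n], Borel-Cantelli applies to the [F k] that meet the set
    [U <= n] inside the limsup: such an [F k] has measure at most
    [(n + L) / a k]. *)
Lemma ae_pinfty_lim_sup_set d (T : measurableType d) (R : realType)
    (mu : probability T R) (U : T -> \bar R) (F : (set T)^nat) (a : nat -> R)
    (L : R) :
  (forall k, measurable (F k)) -> (forall k, 0 < a k) -> 0 <= L ->
  cvgn (series (fun k => (a k)^-1)) ->
  (forall k w, lim_sup_set F w -> F k w ->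
    (a k)%:E * mu (F k) - L%:E <= U w)%E ->
  exists N, [/\ measurable N, mu N = 0%E &
    forall w, lim_sup_set F w -> ~ N w -> U w = +oo%E].
Proof.
move=> mF a0 L0 ca FU.
pose G (n k : nat) := if `[<
  exists w, [/\ lim_sup_set F w, F k w & (U w <= n%:R%:E)%E] >] then F k else set0.
have mG n k : measurable (G n k) by rewrite /G; case: ifP.
have mlimG n : measurable (lim_sup_set (G n)).
  by apply: bigcapT_measurable => k; exact: bigcup_measurable.
have G0 n : mu (lim_sup_set (G n)) = 0%E.
  apply: lim_sup_set_cvg0 => //.
  apply: (@le_lt_trans _ _ (\sum_(k <oo) ((n%:R + L)%:E * ((a k)^-1)%:E))%E).
    apply: lee_nneseries => // k _; rewrite /G; case: ifPn; last first.
      move=> _; rewrite measure0 -EFinM lee_fin.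
      by apply: mulr_ge0; [exact: addr_ge0|rewrite invr_ge0 ltW].
    move=> /asboolP[w [Xw Fw Uw]]; have := le_trans (FU _ _ Xw Fw) Uw.
    by rewrite leeBlDr// -EFinD muleC -lee_pdivlMr.
  rewrite nneseriesZl; last by move=> k _; rewrite lee_fin invr_ge0 ltW.
  rewrite (_ : \sum_(k <oo) _ = (limn (series (fun k => (a k)^-1)))%:E)%E.
    by rewrite -EFinM ltry.
  rewrite -EFin_lim//; congr (limn _); apply/funext => m /=.
  by rewrite sumEFin.
exists (\bigcup_n lim_sup_set (G n)); split.
- by apply: bigcupT_measurable => n; exact: mlimG.
- apply/negligibleP.
    by apply: bigcupT_measurable => n; exact: mlimG.
  apply: negligible_bigcup => n; apply/negligibleP; first exact: mlimG.
  exact: G0.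
- move=> w Fw Nw; apply/eqP; rewrite -leye_eq leNgt; apply/negP => Uoo.
  apply: Nw; have [n Un] : exists n : nat, (U w <= n%:R%:E)%E.
    case: (U w) Uoo => [u _|//|_]; last by exists 0%N; exact: leNye.
    by exists (Num.truncn u).+1; rewrite lee_fin ltW// truncnS_gt.
  exists n => // m _; have [k mk Fk] := Fw m I.
  by exists k => //; rewrite /G ifT//; apply/asboolP; exists w.
Qed.

(** * Borel sets and distances in the complex plane *)

(** A real function that is 1-Lipschitz for the modulus is continuous, hence
    Borel. *)
Lemma measurable_fun_lipschitz_normc (R : realType) (f : R[i] -> R) :
  (forall z w : R[i], `|f z - f w| <= Normc.normc (z - w)) ->
  measurable_fun setT (f : borelC R -> R).
Proof.
move=> fL; apply: (measurability _ (RGenOpens.measurableE R)).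
move=> _ [_ [a [b ->] <-]]; rewrite setTI; apply: sub_sigma_algebra => /=.
have cf : continuous (f : R[i]^o -> R).
  move=> z; apply/(@cvgrPdist_lt _ _ _ _ (nbhs_filter (z : R[i]^o))) => e e0.
  near=> w.
  apply: le_lt_trans (fL _ _) _; rewrite -ltcR.
  (* The norm of R[i] is the modulus seen as a complex number. *)
  change (`|(z : R[i]^o) - w| < e%:C%C).
  near: w; apply: (nbhsx_ballx (z : R[i]^o) e%:C%C).
  by rewrite ltcR.
by move/continuousP: cf; apply; exact: interval_open.
Unshelve. all: by end_near. Qed.

Lemma measurable_real_in_C (R : realType) (A : set R) :
  measurable A -> measurable (real_in_C A : set (borelC R)).
Proof.
move=> mA.
have -> : real_in_C A =
    (@complex.Im R) @^-1` [set 0] `&` (@complex.Re R) @^-1` A.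
  by apply/seteqP; split => [_ [x Ax <-]//|[x y] /= [-> Ax]]; exists x.
have mRe : measurable_fun setT (@complex.Re R : borelC R -> R).
  apply: measurable_fun_lipschitz_normc => z w.
  by rewrite -raddfB -lecR; exact: normc_ge_Re.
have mIm : measurable_fun setT (@complex.Im R : borelC R -> R).
  apply: measurable_fun_lipschitz_normc => -[a b] [c d] /=.
  by rewrite -sqrtr_sqr ler_wsqrtr// lerDr sqr_ge0.
apply: measurableI; rewrite -[X in measurable X]setTI.
  by apply: mIm => //; exact: measurable_set1.
exact: mRe.
Qed.

Lemma bounded_normc (R : realType) (X : set R[i]) :
  bounded_set (X : set R[i]^o) ->
  exists2 B : R, 0 < B & forall z, X z -> Normc.normc z <= B.
Proof.
move=> /pinfty_ex_gt0[M M0 XM]; exists (complex.Re M).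
  by move: M0; rewrite ltcE => /andP[].
by move=> z /XM; rewrite /= lecE => /andP[].
Qed.

(** With [x <= y] two points of the interval, [`[x, y]] lies in it, so
    monotonicity of the measure bounds [y - x] without a discussion of the
    endpoints. *)
Lemma normc_real_in_C_itv (R : realType) (i : interval R) (r : R)
    (z w : R[i]) :
  (lebesgue_measure [set` i] <= r%:E)%E -> real_in_C [set` i] z ->
  real_in_C [set` i] w -> Normc.normc (z - w) <= r.
Proof.
move=> ir [x ix <-] [y iy <-]; rewrite -lecR.
rewrite -[leLHS]/(`|(x%:C - y%:C)%C|) -raddfB.
have -> : `|((x - y)%:C)%C| = (`|x - y|%:C)%C.
  by rewrite normc_def /= expr0n /= addr0 sqrtr_sqr.
rewrite lecR -lee_fin; apply: le_trans ir.
wlog xy : x y ix iy / x <= y.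
  move=> h; have [/h|/ltW/h] := leP x y; first exact.
  by rewrite distrC; exact.
rewrite distrC ger0_norm ?subr_ge0//.
have := lebesgue_measure_itv `[x, y]; rewrite /= lte_fin.
move: xy; rewrite le_eqVlt => /predU1P[->|xy]; first by rewrite subrr.
rewrite xy -EFinB => <-; apply: le_measure; rewrite ?inE//=.
by move=> t /=; rewrite in_itv => /= ?; apply: (interval_is_interval ix iy).
Qed.

Lemma le_log_kernel (R : realType) (r : R) (z w : R[i]) :
  0 < r -> Normc.normc (z - w) <= r -> (- (ln r)%:E <= log_kernel z w)%E.
Proof.
move=> r0 zw; rewrite /log_kernel leeN2.
have [n0|n0] := leP (Normc.normc (z - w)) 0; first by rewrite le0_lneNy ?leNye.
by rewrite lne_EFin// lee_fin ler_ln.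
Qed.

(** * Capacity of limsup sets *)

(** The potential of a probability [mu] carried by the limsup set is infinite on
    it outside a null set, hence [mu] has energy at least [+oo * 1]; the
    infimum of the energies is then [+oo], even if there is no such [mu]. *)
Lemma capacity_lim_sup_eq0 (R : realType) (F : nat -> set R[i])
    (r : nat -> R) :
  (forall k, measurable (F k : set (borelC R))) ->
  (forall k, 0 < r k < 1) ->
  (forall k z w, F k z -> F k w -> Normc.normc (z - w) <= r k) ->
  bounded_set (lim_sup_set F : set R[i]^o) ->
  cvgn (series (fun k => `|ln (r k)|^-1)) ->
  capacity (lim_sup_set F) = 0%E.
Proof.
move=> mF r01 Fr /bounded_normc[B B0 XB] cr; rewrite /capacity.
suff -> : ereal_inf [set energy mu | mu in supported_probas (lim_sup_set F)] =
  +oo%E by [].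
apply/ereal_inf_pinfty => _ [mu muX <-].
have mX : measurable (lim_sup_set F : set (borelC R)).
  by apply: bigcapT_measurable => n; exact: bigcup_measurable.
have normr k : `|ln (r k)| = - ln (r k).
  by have /andP[_ /ltW r1] := r01 k; rewrite ler0_norm// ln_le0.
(* Two points of X are at distance at most 2B. *)
pose L := Num.max 0 (ln (B + B)).
have L0 : 0 <= L by rewrite le_max lexx.
have kerL z w : lim_sup_set F z -> lim_sup_set F w ->
    (- L%:E <= log_kernel z w)%E.
  move=> Xz Xw; apply: (@le_trans _ _ (- (ln (B + B))%:E)%E).
    by rewrite leeN2 lee_fin le_max lexx orbT.
  apply: le_log_kernel; first exact: addr_gt0.
  by rewrite (le_trans (le_normcD _ _))// normcN lerD ?XB.
pose U (w : borelC R) := (\int[mu]_z log_kernel z w)%E.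
have a0 k : 0 < `|ln (r k)|.
  by rewrite normr_gt0 lt_eqF// ln_lt0.
have UF k w : lim_sup_set F w -> F k w ->
    (`|ln (r k)|%:E * mu (F k) - L%:E <= U w)%E.
  move=> Xw Fw; apply: (@integral_ge_cstB _ _ _ mu _ _
    (fun z => log_kernel z w) _ _ (mF k) mX muX) => // z Xz.
    by rewrite normr EFinN le_log_kernel ?Fr//; have /andP[] := r01 k.
  exact: kerL.
have [N [mN N0 UN]] := ae_pinfty_lim_sup_set mF a0 L0 cr UF.
have mXN : measurable (lim_sup_set F `\` N : set (borelC R)).
  exact: measurableD.
have XN0 : mu (~` (lim_sup_set F `\` N)) = 0%E.
  rewrite setCD; apply/negligibleP.
    by apply: measurableU => //; exact: measurableC.
  by apply: negligibleU; apply/negligibleP => //; exact: measurableC.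
apply/eqP; rewrite -leye_eq.
have := integral_ge_cstB (f := U) (c := +oo%E) mXN mXN XN0 le0y (lexx 0).
rewrite oppe0 adde0.
have -> : (+oo * mu (lim_sup_set F `\` N) = +oo)%E.
  have : (mu (~` (~` (lim_sup_set F `\` N))) = 1)%E.
    by rewrite probability_setC ?XN0 ?sube0//; exact: measurableC.
  by rewrite setCK => ->; rewrite mule1.
by apply => w [Xw Nw]; rewrite UN.
Qed.

Theorem corollary1p4 (R : realType) (I : nat -> interval R) (r : nat -> R)
  (hr : forall k, 0 < r k < 1)
  (hI : forall k, lebesgue_measure [set` I k] = (r k)%:E)
  (hbounded : bounded_set
     (real_in_C (lim_sup_set (fun k => [set` I k])) : set R[i]^o))
  (hconv : cvgn (series (fun k => 1 / `|ln (r k)|))) :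
  capacity (real_in_C (lim_sup_set (fun k => [set` I k]))) = 0%E.
Proof.
pose F k := real_in_C [set` I k].
(* The image under the embedding commutes with limsup, as it is injective. *)
have FE : real_in_C (lim_sup_set (fun k => [set` I k])) = lim_sup_set F.
  apply/seteqP; split => [_ [x Ix <-] n _|z Fz].
    by have [k nk Ik] := Ix n Logic.I; exists k => //; exists x.
  have [_ _ [x _ xz]] := Fz 0 Logic.I.
  exists x => // n _; have [k nk [y Iy yz]] := Fz n Logic.I.
  by exists k => //; move: yz; rewrite -xz => -[<-].
rewrite FE in hbounded *; apply: (@capacity_lim_sup_eq0 _ _ r) => //.
- by move=> k; exact: measurable_real_in_C.
- by move=> k z w; apply: normc_real_in_C_itv; rewrite hI.
- by move: hconv; under eq_fun do rewrite div1r.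
Qed.
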